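(* Let $G$ be a finite group, let $p$ be the smallest prime dividing $|G|$, and let $P$ be a non-trivial normal $p$-subgroup of $G$. If $\exp(P)=p$ and every minimal subgroup of $P$ not having a supersoluble supplement in $G$ is weakly $S\Phi$-supplemented in $G$, then every chief factor of $G$ below $P$ is cyclic.
   Context: All groups are finite. A minimal subgroup is a subgroup of prime order; $\exp(P)$ is the exponent of $P$. A supersoluble supplement of a subgroup $H$ in $G$ is a supersoluble subgroup $T\le G$ with $G=HT$. A chief factor of $G$ below $P$ is a chief factor $H/K$ of $G$ with $K<H\le P$. A subgroup $A$ of $G$ is $S$-permutable in $G$ if $AQ=QA$ for all Sylow subgroups $Q$ of $G$ (for all primes). For a subgroup $H\le G$, $H_{sG}$ denotes the subgroup of $H$ generated by all subgroups of $H$ which are $S$-permutable in $G$. $\Phi(H)$ denotes the Frattini subgroup of $H$. A subgroup $H$ of $G$ is weakly $S\Phi$-supplemented in $G$ if there exists a subgroup $T$ of $G$ such that $G=HT$ and $H\cap T\le \Phi(H)H_{sG}$. *)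

(* Defs.v *)
From mathcomp Require Import all_boot all_fingroup all_solvable.

Set Implicit Arguments.
Unset Strict Implicit.
Unset Printing Implicit Defensive.

Import GroupScope.

Section SPhiSupplements.

Variable gT : finGroupType.
Implicit Types G H A T U V : {group gT}.

(* The terms of the series are required to be normal in G, and not merely in
   the next term. *)
Definition supersoluble G : Prop :=
  exists2 s : seq {group gT},
      path [rel U V : {group gT} |
        [&& U \subset V, U <| G, V <| G & cyclic (V / U)]] 1%G s
    & last 1%G s = G.

Definition supersoluble_supplement G H T : Prop :=
  [/\ T \subset G, supersoluble T & H * T = G].

Definition s_permutable G A : bool :=
  (A \subset G) && [forall Q : {group gT}, Sylow G Q ==> (A * Q == Q * A)].

Definition s_core G H : {set gT} :=
  <<\bigcup_(A : {group gT} | (A \subset H) && s_permutable G A) A>>.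

(* 'Phi(H) is normal in H, so the product of sets below is a subgroup. *)
Definition weakly_SPhi_supplemented G H : Prop :=
  exists T : {group gT},
    [/\ T \subset G, H * T = G & H :&: T \subset 'Phi(H) * s_core G H].

End SPhiSupplements.

(* Main.v *)
Require Import Defs.
From mathcomp Require Import all_boot all_fingroup all_solvable.
Import GroupScope.

(** Unless [G] is supersoluble, every Sylow subgroup [Q] of [G] for a prime other
    than [p] centralises [P], as explained below.  Then [G] acts on [P] as a
    [p]-group, and an irreducible section of a [p]-group under a [p]-group
    of operators is central of order [p].  If [G] is supersoluble, a normal
    series with cyclic factors, traced on a chief factor, jumps from bottom to
    top in a single step, so the chief factor is cyclic
    ([supersoluble_chief_cyclic]).

    The choice of [p] enters through [coprime #|G| p.-1]: a subgroup of [G] that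
    acts on a group of order [p] acts trivially.  It follows that minimal
    subgroups [L] of [[~: P, G]] have no proper supplement in [G]
    ([commg_sub_supplement]): a proper supplement [T] of [L <= P] meets [P] in
    a normal subgroup of [G] of index [p] in [P], and [G] then centralises
    [P / (P :&: T)], whence [L <= [~: P, G] <= T].  So when [G] is not
    supersoluble the hypothesis on [L] forces [L] to be S-permutable, which
    makes every [p']-Sylow subgroup [Q] normalise, hence centralise, [L].
    As [P] has exponent [p], the subgroups [L] of order [p] cover [[~: P, Q]];
    thus [Q] centralises [[~: P, Q]] and, the action being coprime, it
    centralises [P]. *)

(** * Chief factors of supersoluble groups *)

Lemma quotient_cyclic_sub {gT : finGroupType} {A U V K : {group gT}} :
    A \subset V -> A \subset 'N(U) -> A \subset 'N(K) ->
    U :&: A \subset K -> cyclic (V / U) -> cyclic (A / K).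
Proof.
move=> sAV nUA nKA sUAK cycVU.
have cycAU: cyclic (A / (U :&: A)).
  by rewrite (isog_cyclic (second_isog nUA)) (cyclicS (quotientS U sAV)).
have nIA: A \subset 'N(U :&: A) by rewrite normsI ?normG.
have /homgP[f <-] := homg_quotientS nIA nKA sUAK.
exact: morphim_cyclic.
Qed.

(** Each term [V] of the series gives a normal subgroup [(V :&: H) <*> K] of [G]
    between [K] and [H], which is [K] or [H]; the chief factor is a section of
    the factor of the series at which [H] first occurs. *)
Lemma chief_cyclic_of_path {gT : finGroupType} {G H K : {group gT}}
    (s : seq {group gT}) (U : {group gT}) :
    chief_factor G K H ->
    path [rel U V : {group gT} |
      [&& U \subset V, U <| G, V <| G & cyclic (V / U)]] U s ->
    U :&: H \subset K -> H \subset last U s -> cyclic (H / K).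
Proof.
case/andP=> /maxgroupP[/andP[prKH nKG] maxK] /andP[sHG nHG].
have sKH := proper_sub prKH.
elim: s U => [|V s IHs] U /=.
  move=> _ sUHK sHU; case/andP: prKH => _ /negP[].
  by apply: subset_trans sUHK; rewrite subsetI sHU subxx.
case/andP=> /and4P[sUV nsUG nsVG cycVU] pathVs sUHK sHs.
have nVHG: G \subset 'N((V :&: H) <*> K).
  by rewrite normsY // normsI // normal_norm.
have sWH: (V :&: H) <*> K \subset H by rewrite join_subG subsetIr.
have [eqWH | neWH] := eqVneq ((V :&: H) <*> K)%G H; last first.
  apply: IHs pathVs _ sHs.
  have eqWK: (V :&: H) <*> K = K.
    rewrite -[RHS](maxK ((V :&: H) <*> K)%G) //= ?joing_subr //.
    by rewrite properEneq neWH sWH nVHG.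
  by have := joing_subl (V :&: H) K; rewrite eqWK.
have sVHG: V :&: H \subset G by rewrite subIset // sHG orbT.
have nKVH := subset_trans sVHG nKG.
have -> : H / K = (V :&: H) / K.
  by rewrite -[in LHS]eqWH /= quotientYidr.
apply: quotient_cyclic_sub cycVU => //; first exact: subsetIl.
  exact: subset_trans sVHG (normal_norm nsUG).
by apply: subset_trans sUHK; rewrite setIS ?subsetIr.
Qed.

Lemma supersoluble_chief_cyclic {gT : finGroupType} {G H K : {group gT}} :
  supersoluble G -> chief_factor G K H -> cyclic (H / K).
Proof.
case=> s pathGs lastG chiefKH.
apply: (chief_cyclic_of_path s 1%G chiefKH) => //.
  by rewrite (subset_trans (subsetIl _ _)) ?sub1G.
by rewrite lastG; case/andP: chiefKH => _ /normal_sub.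
Qed.

(** * Chief factors on which the group acts as a p-group *)

(** The normal subgroup [H / K] of the nilpotent group [S / K] meets its centre
    non-trivially, and every element of the intersection is central in [G / K],
    so that it generates a normal subgroup there. *)
Lemma pgroup_action_chief_cyclic {gT : finGroupType} {p : nat}
    {G S H K : {group gT}} :
    p.-group S -> S * 'C_G(H) = G -> chief_factor G K H -> H \subset S ->
  cyclic (H / K).
Proof.
move=> pS defG chiefKH sHS.
have sSG: S \subset G by rewrite -defG mulG_subl.
have /mingroupP[/andP[ntHK _] minHK] := chief_factor_minnormal chiefKH.
case/andP: chiefKH => /maxgroupP[/andP[/proper_sub sKH nKG] _] /andP[_ nHG].
have nsHS: H / K <| S / K.
  by rewrite quotient_normal // /normal sHS (subset_trans sSG nHG).
have nilSK: nilpotent (S / K) := pgroup_nil (quotient_pgroup K pS).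
have /trivgPn[x /setIP[Hx Zx] ntx] := meet_center_nil nilSK nsHS ntHK.
suff eqx: <[x]> = H / K by rewrite -eqx cycle_cyclic.
rewrite -[RHS](minHK <[x]>%G) //=; last by rewrite cycle_subG.
  rewrite cycle_eq1 ntx cents_norm // -defG quotientMl ?(subset_trans sSG) //.
  case/setIP: Zx => _ CSx.
  rewrite mul_subG //= cent_cycle ?sub_cent1 //.
  apply: (subsetP _ x Hx); rewrite centsC quotient_cents //.
  exact: subsetIr.
Qed.

(** * Actions on groups of order p *)

(** The automorphism group of a group of prime order [p] has order [p.-1]. *)
Lemma coprime_norm_prime_cent {gT : finGroupType} {A B : {group gT}} :
    prime #|B| -> A \subset 'N(B) -> coprime #|A| #|B|.-1 -> A \subset 'C(B).
Proof.
move=> prB nBA coAB; rewrite -ker_conj_aut ker_trivg_morphim nBA /=.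
rewrite subG1 trivg_card1 -dvdn1 -(eqP coAB) dvdn_gcd dvdn_morphim /=.
rewrite -totient_prime // -card_Aut_cyclic ?prime_cyclic //.
by rewrite cardSg // Aut_conj_aut.
Qed.

(** A non-trivial common divisor of [n] and [(pdiv n).-1] would be a divisor of
    [n] smaller than [pdiv n]. *)
Lemma coprime_pdiv_pred (n : nat) : 0 < n -> coprime n (pdiv n).-1.
Proof.
case: n => [|[|n]] // _; set m := n.+2.
have pr_p: prime (pdiv m) by apply: pdiv_prime.
have p1_gt0: 0 < (pdiv m).-1 by rewrite -subn1 subn_gt0 prime_gt1.
apply: contraT; rewrite /coprime => neq1.
have d_gt0: 0 < gcdn m (pdiv m).-1 by rewrite gcdn_gt0.
have d_gt1: 1 < gcdn m (pdiv m).-1 by rewrite ltn_neqAle eq_sym neq1.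
have := leq_trans (pdiv_min_dvd d_gt1 (dvdn_gcdl _ _))
  (dvdn_leq p1_gt0 (dvdn_gcdr _ _)).
by rewrite -ltnS prednK ?ltnn // prime_gt0.
Qed.

(** If [T] is proper it complements [L], and [P :&: T] is a maximal subgroup of
    [P] normalised by both [P] and [T]; the quotient [P / (P :&: T)] of order
    [p] is then centralised by [G]. *)
Lemma commg_sub_supplement {gT : finGroupType} {p : nat}
    {G P L T : {group gT}} :
    coprime #|G| p.-1 -> p.-group P -> P <| G ->
    L \subset P -> prime #|L| -> T \subset G -> L * T = G ->
  [~: P, G] \subset T.
Proof.
move=> coGp pP nsPG sLP prL sTG defG.
have [sPG nPG] := andP nsPG.
have [sLT | nsLT] := boolP (L \subset T).
  by rewrite -(mulSGid sLT) defG commg_subr (subset_trans sPG (normG G)).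
set M := (T :&: P)%G.
have tiLT: L :&: T = 1 by apply: prime_TIg.
have defP: L * M = P by rewrite group_modl // defG; apply/setIidPr.
have sMP: M \subset P by apply: subsetIr.
have indM: #|P : M| = #|L|.
  rewrite -divgS // -defP TI_cardMg ?mulnK //.
  by apply/trivgP; rewrite -tiLT setIS ?subsetIl.
have maxM: maximal M P by apply: p_index_maximal; rewrite ?indM.
have nMP := normal_norm (p_maximal_normal pP maxM).
have nMG: G \subset 'N(M).
  rewrite -defG mul_subG ?(subset_trans sLP) //.
  by rewrite normsI ?normG // (subset_trans sTG).
have oPM: #|P / M| = p by rewrite card_quotient // (p_maximal_index pP).
suff sDM: [~: P, G] \subset M by apply: subset_trans sDM (subsetIl _ _).
rewrite commGC -quotient_cents2 // coprime_norm_prime_cent ?quotient_norms //.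
  by rewrite card_quotient // indM.
by rewrite oPM (coprime_dvdl _ coGp) // dvdn_quotient.
Qed.

(** * Supplements and S-permutability of minimal subgroups *)

(** [L] is the intersection of the group [L * Q] with [P]. *)
Lemma s_permutable_norm {gT : finGroupType} {G P L Q : {group gT}} :
    P <| G -> L \subset P -> s_permutable G L -> Sylow G Q ->
  coprime #|P| #|Q| -> Q \subset 'N(L).
Proof.
move=> nsPG sLP /andP[_ /forallP/(_ Q)/implyP permL] sylQ coPQ.
have sQG: Q \subset G by case/and3P: sylQ.
have defLQ: L <*> Q = L * Q by apply/comm_joingE/eqP/permL.
have -> : L :=: (L <*> Q) :&: P.
  by rewrite defLQ -group_modl // setIC coprime_TIg ?mulg1.
rewrite normsI ?(subset_trans sQG (normal_norm nsPG)) //.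
exact: subset_trans (joing_subr L Q) (normG _).
Qed.

(** The Frattini subgroup of a group of prime order is trivial, and its only
    non-trivial subgroup is itself. *)
Lemma prime_sub_s_core {gT : finGroupType} {G L : {group gT}} :
  prime #|L| -> L \subset 'Phi(L) * s_core G L -> s_permutable G L.
Proof.
move=> prL; have abelL := prime_abelem prL (erefl #|L|).
have -> : 'Phi(L) = 1.
  by apply/eqP; rewrite (trivg_Phi (abelem_pgroup abelL)).
rewrite mul1g => sLs.
have [ // | nperm] := boolP (s_permutable G L).
suff: L \subset [1 gT] by rewrite subG1 trivg_card1 gtn_eqF ?prime_gt1.
rewrite (subset_trans sLs) // gen_subG; apply/bigcupsP=> A /andP[sAL permA].
have [-> // | ntA] := eqVneq (gval A) 1.
have sLA: L \subset A by apply: prime_meetG; rewrite ?(setIidPr sAL).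
have eqAL: A = L by apply/val_inj/eqP; rewrite eqEsubset sAL.
by rewrite -eqAL permA in nperm.
Qed.

(** * Centralising the normal p-subgroup *)

(** [A] acts trivially on [P / [~: P, A]], and by coprimeness the fixed points
    of [A] on this quotient come from fixed points on [P]. *)
Lemma coprime_commg_cent {gT : finGroupType} {A P : {group gT}} :
    A \subset 'N(P) -> coprime #|P| #|A| -> solvable P ->
  [~: P, A] \subset 'C(A) -> P \subset 'C(A).
Proof.
move=> nPA coPA solP cDA; set D := [~: P, A]%G.
have sDP: D \subset P by rewrite /= commg_subl.
have nDP: P \subset 'N(D) by apply: commg_norml.
have nDA: A \subset 'N(D) by apply: commg_normr.
have := coprime_quotient_cent sDP nDA coPA solP.
rewrite (setIidPl (quotient_cents2r (subxx D))) => eqCP.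
have sPC: P \subset 'C_P(A).
  by rewrite -(quotientSGK nDP) ?eqCP // subsetI sDP.
exact: subset_trans sPC (subsetIr _ _).
Qed.

Lemma exponent_prime_sub_cent {gT : finGroupType} {p : nat}
    {D A : {group gT}} :
    prime p -> exponent D %| p ->
    (forall L : {group gT}, L \subset D -> prime #|L| -> A \subset 'C(L)) ->
  A \subset 'C(D).
Proof.
move=> prp expD cent; rewrite centsC; apply/subsetP=> x Dx.
have [-> | ntx] := eqVneq x 1; first exact: group1.
rewrite -cycle_subG centsC; apply: cent; first by rewrite cycle_subG.
have /primeP[_ /(_ #[x])] := prp.
rewrite (dvdn_trans (dvdn_exponent Dx)) // => /(_ isT).
by rewrite order_eq1 (negPf ntx) => /eqP ox; rewrite -orderE ox.
Qed.

Theorem theorem3p2 (gT : finGroupType) (G P : {group gT}) (p : nat)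
    (p_min : p = pdiv #|G|)
    (P_normal : P <| G) (P_pgroup : p.-group P) (P_nontrivial : P :!=: 1)
    (P_exponent : exponent P = p)
    (P_minimal_subgroups : forall L : {group gT},
       L \subset P -> prime #|L| ->
       ~ (exists T : {group gT}, supersoluble_supplement G L T) ->
       weakly_SPhi_supplemented G L) :
  forall H K : {group gT},
    chief_factor G K H -> H \subset P -> cyclic (H / K).
Proof.
move=> H K chiefKH sHP; apply: contraT => ncycHK.
have nsolG: ~ supersoluble G.
  by move=> solG; rewrite (supersoluble_chief_cyclic solG chiefKH) in ncycHK.
have [sPG nPG] := andP P_normal.
have prp: prime p.
  by rewrite p_min pdiv_prime // (leq_trans _ (subset_leq_card sPG)) ?cardG_gt1.
have coGp: coprime #|G| p.-1 by rewrite p_min coprime_pdiv_pred.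
have oL (L : {group gT}) : L \subset P -> prime #|L| -> #|L| = p.
  move=> sLP prL; have pL: p.-nat #|L| := pgroupS sLP P_pgroup.
  by apply/eqP; move: pL; rewrite pnatE.
have permL (L : {group gT}) :
    L \subset [~: P, G] -> prime #|L| -> s_permutable G L.
  move=> sLD prL.
  have sLP: L \subset P by apply: subset_trans sLD _; rewrite commg_subl.
  have noT (T : {group gT}) : T \subset G -> L * T = G -> T = G.
    move=> sTG defG; apply: val_inj; rewrite /= -[RHS]defG mulSGid //.
    apply: subset_trans sLD _.
    exact: commg_sub_supplement coGp P_pgroup P_normal sLP prL sTG defG.
  have [|T [sTG defG]] := P_minimal_subgroups L sLP prL.
    by case=> T [sTG solT defG]; apply: nsolG; rewrite -(noT T sTG defG).
  rewrite (noT T sTG defG) (setIidPl (subset_trans sLP sPG)).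
  exact: prime_sub_s_core.
have centQ (q : nat) (Q : {group gT}) :
    prime q -> q != p -> q.-Sylow(G) Q -> Q \subset 'C(P).
  move=> prq neqp sylQ; have sQG := pHall_sub sylQ.
  have coPQ: coprime #|P| #|Q|.
    apply: pnat_coprime P_pgroup _; apply: pi_pnat (pHall_pgroup sylQ) _.
    by rewrite !inE.
  have nPQ := subset_trans sQG nPG.
  rewrite centsC; apply: coprime_commg_cent (pgroup_sol P_pgroup) _ => //.
  have sDP: [~: P, Q] \subset P by rewrite commg_subl.
  rewrite centsC; apply: (exponent_prime_sub_cent prp) => [|L sLD prL].
    by rewrite -[X in _ %| X]P_exponent exponentS.
  have sLP := subset_trans sLD sDP.
  apply: coprime_norm_prime_cent => //.
    apply: s_permutable_norm P_normal sLP _ (p_Sylow sylQ) coPQ.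
    by apply: permL => //; apply: subset_trans sLD (commgS _ sQG).
  by rewrite (oL L) //; apply: coprime_dvdl coGp; apply: cardSg.
(* All Sylow subgroups for primes other than p lie in 'C_G(P), whose index is
   thus a power of p and which a Sylow p-subgroup S supplements. *)
have [S sylS] := Sylow_exists p G.
have sPS: P \subset S.
  exact: normal_sub_max_pgroup (Hall_max sylS) P_pgroup P_normal.
have sCG: 'C_G(P) \subset G by apply: subsetIl.
have pC: p.-nat #|G : 'C_G(P)|.
  apply/pnatP=> // q prq q_dv; rewrite inE; apply: contraLR q_dv => neqp.
  have [Q sylQ] := Sylow_exists q G.
  have sQC: Q \subset 'C_G(P).
    by rewrite subsetI (pHall_sub sylQ) (centQ q).
  rewrite -p'natE //; apply: pnat_dvd (indexgS G sQC) _.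
  by case/and3P: sylQ.
have defG: S * 'C_G(P) = G.
  apply: coprime_index_mulG; rewrite ?(pHall_sub sylS) // coprime_sym.
  by apply: pnat_coprime pC _; case/and3P: sylS.
have defGH: S * 'C_G(H) = G.
  apply/eqP; rewrite eqEsubset mul_subG ?(pHall_sub sylS) ?subsetIl //=.
  by rewrite -{1}defG mulgS // setIS ?centS.
have cycHK := pgroup_action_chief_cyclic (pHall_pgroup sylS) defGH chiefKH
  (subset_trans sHP sPS).
by rewrite cycHK in ncycHK.
Qed.
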